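(* Let $n$ be a positive integer, let $e=O(\theta)$ be the order of $\theta$, suppose $e\nmid n$, and let $d=\gcd(n,e)$. If $C$ is a skew cyclic code (with respect to $\theta$) of length $n$ over $S=\mathbb{F}_p+v\mathbb{F}_p$, then $C$ is equivalent to a quasi-cyclic code of length $n$ over $S$ with index $d$.
   Context: $p$ is an odd prime, $S=\mathbb{F}_p+v\mathbb{F}_p=\{a+bv: a,b\in\mathbb{F}_p\}$ with $v^2=0$ (so $S\cong\mathbb{F}_p[v]/\langle v^2\rangle$), and $\theta$ is the ring automorphism of $S$ with $\theta(a+bv)=a+\alpha b v$ for a fixed $\alpha\in\mathbb{F}_p^*$, of order $e>1$. A linear code of length $n$ over $S$ is an $S$-submodule of $S^n$. A linear code $C\subseteq S^n$ is a skew cyclic code (with respect to $\theta$) if $(c_0,c_1,\dots,c_{n-1})\in C$ implies $(\theta(c_{n-1}),\theta(c_0),\dots,\theta(c_{n-2}))\in C$. A linear code of length $n$ is quasi-cyclic with index $d$ (where $d\mid n$) if it is invariant under the cyclic shift of coordinates by $d$ positions. Two codes are equivalent if one is obtained from the other by a permutation of the coordinates (in particular, equal codes are equivalent). *)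

(* Defs.v *)
From HB Require Import structures.
From mathcomp Require Import all_boot all_order all_algebra all_fingroup.

Set Implicit Arguments.
Unset Strict Implicit.
Unset Printing Implicit Defensive.

Import GRing.Theory.
Local Open Scope ring_scope.

(* The ring F_p + v F_p with v^2 = 0, as F_p[v]/(v^2). The alias carries both  *)
(* the finite-type and the algebra structures of the quotient.                *)
Definition FpvFp (p : nat) := {poly %/ ('X^2 : {poly 'F_p})}.

HB.instance Definition _ p := Finite.on (FpvFp p).
HB.instance Definition _ p := GRing.ComUnitAlgebra.on (FpvFp p).

Definition vS (p : nat) : FpvFp p := 'qX.

Section DualRing.

Variable p : nat.
Local Notation S := (FpvFp p).
Local Notation v := (vS p).

Lemma vS_polyE : v = 'X :> {poly 'F_p}.
Proof. by rewrite qpolyXE ?size_polyXn ?monicXn. Qed.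

Lemma vS_sqr : v ^+ 2 = 0.
Proof.
apply/val_inj/(etrans (poly_of_qpolyM v v)).
by rewrite vS_polyE -expr2 [mk_monic _ in LHS]mk_monic_Xn Pdiv.RingMonic.rmodpp ?monicXn.
Qed.

Lemma coef0_FpvFp (a b : 'F_p) : (a%:A + b *: v : S)`_0 = a.
Proof.
rewrite poly_of_qpolyD coefD !poly_of_qpolyZ !coefZ vS_polyE coefX coefC.
by rewrite /= mulr1 mulr0 addr0.
Qed.

Lemma coef1_FpvFp (a b : 'F_p) : (a%:A + b *: v : S)`_1 = b.
Proof.
rewrite poly_of_qpolyD coefD !poly_of_qpolyZ !coefZ vS_polyE coefX coefC.
by rewrite /= mulr1 mulr0 add0r.
Qed.

Lemma FpvFpE (x : S) : x = (x`_0)%:A + x`_1 *: v.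
Proof.
apply: val_inj; apply/polyP => -[|[|i]]; rewrite ?coef0_FpvFp ?coef1_FpvFp //.
have size2 (y : S) : (size (y : {poly 'F_p}) <= i.+2)%N.
  rewrite -ltnS (leq_trans (size_mk_monic y)) //.
  by rewrite mk_monic_Xn size_polyXn.
by rewrite (nth_default _ (size2 x)) [RHS](nth_default _ (size2 _)).
Qed.

End DualRing.

Definition theta (p : nat) (alpha : {unit 'F_p}) (x : FpvFp p) : FpvFp p :=
  (x`_0)%:A + (val alpha * x`_1) *: vS p.

Section Theta.

Variables (p : nat) (alpha : {unit 'F_p}).
Local Notation S := (FpvFp p).
Local Notation v := (vS p).
Local Notation theta := (theta alpha).

Lemma thetaE (a b : 'F_p) : theta (a%:A + b *: v) = a%:A + (val alpha * b) *: v.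
Proof. by rewrite /Defs.theta coef0_FpvFp coef1_FpvFp. Qed.

Fact theta_is_zmod_morphism : zmod_morphism theta.
Proof.
move=> x y; rewrite /Defs.theta.
have cB i : (x - y)`_i = x`_i - y`_i by rewrite coefB.
by rewrite !cB mulrBr !scalerBl opprD addrACA.
Qed.

Lemma FpvFp_mulE (a b c d : 'F_p) :
  (a%:A + b *: v) * (c%:A + d *: v) = (a * c)%:A + (a * d + b * c) *: v.
Proof.
rewrite mulrDl !mulrDr -!scalerAl -!scalerAr !mul1r !mulr1.
by rewrite -expr2 vS_sqr !scaler0 addr0 !scalerA -addrA -scalerDl.
Qed.

Fact theta_is_monoid_morphism : monoid_morphism theta.
Proof.
split=> [|x y].
  by have := thetaE 1 0; rewrite mulr0 !scale0r !addr0 scale1r.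
rewrite (FpvFpE x) (FpvFpE y) FpvFp_mulE !thetaE FpvFp_mulE.
by congr (_ + _ *: _); rewrite mulrDr mulrCA -[in RHS]mulrA.
Qed.

HB.instance Definition _ :=
  GRing.isZmodMorphism.Build S S theta theta_is_zmod_morphism.
HB.instance Definition _ :=
  GRing.isMonoidMorphism.Build S S theta theta_is_monoid_morphism.

Lemma theta_inj : injective theta.
Proof.
move=> x y; rewrite /Defs.theta => eq_xy.
have e0 := congr1 (fun z : S => z`_0) eq_xy.
have e1 := congr1 (fun z : S => z`_1) eq_xy.
rewrite !coef0_FpvFp in e0; rewrite !coef1_FpvFp in e1.
by rewrite (FpvFpE x) (FpvFpE y) e0 (mulrI (valP alpha) e1).
Qed.

End Theta.

(* theta as an element of the finite group of permutations of S, so that      *)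
(* #[theta_perm alpha] is the order O(theta).                                 *)
Definition theta_perm (p : nat) (alpha : {unit 'F_p}) : {perm FpvFp p} :=
  perm (@theta_inj p alpha).

Section Codes.

Variables (S : finComNzRingType) (n : nat).
Implicit Types (C D : {set 'rV[S]_n}) (c : 'rV[S]_n) (f : S -> S) (d : nat).

Definition linear_code C : Prop := submod_closed C.

(* ord_pred is the cyclic predecessor: (c_0, ..., c_(n-1)) is sent to         *)
(* (f c_(n-1), f c_0, ..., f c_(n-2)).                                        *)
Definition skew_shift f c : 'rV[S]_n := \row_i f (c ord0 (ord_pred i)).

Definition cyclic_shift c : 'rV[S]_n := \row_i c ord0 (ord_pred i).

Definition skew_cyclic f C : Prop :=
  linear_code C /\ (forall c, c \in C -> skew_shift f c \in C).

Definition quasi_cyclic d C : Prop :=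
  [/\ (d %| n)%N, linear_code C
    & forall c, c \in C -> iter d cyclic_shift c \in C].

Definition code_equiv C D : Prop :=
  exists s : 'S_n, D = [set col_perm s c | c in C].

End Codes.

(* Main.v *)
(* The code C is already quasi-cyclic of index d.  By Bezout there is an
   m = d + a * n divisible by e; the m-th iterate of the skew shift applies
   theta^m = 1 to the coordinates and moves them by m = d (mod n) places, so it
   is the plain cyclic shift by d. *)
Require Import Defs.
From mathcomp Require Import all_boot all_order all_algebra all_fingroup.

Lemma iter_ord_pred_id (n : nat) (i : 'I_n) : iter n (@ord_pred n) i = i.
Proof.
(* The successor is iterated first: its iterates have a closed form modulo [n] with no truncated
   subtraction. The result passes to [ord_pred] by cancellation. *)
have val_iter k (j : 'I_n) : iter k (@ordS n) j = (j + k) %% n :> nat.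
  elim: k => [|k IHk]; first by rewrite addn0 modn_small.
  by rewrite iterS /= IHk -addn1 modnDml addn1 addnS.
have iter_id (j : 'I_n) : iter n (@ordS n) j = j.
  by apply: val_inj; rewrite /= val_iter modnDr modn_small.
have iterK k : cancel (iter k (@ordS n)) (iter k (@ord_pred n)).
  by elim: k => // k IHk j; rewrite iterSr iterS /= ordSK IHk.
by rewrite -[in LHS](iter_id i) iterK.
Qed.

Lemma iter_mul_id (T : Type) (f : T -> T) (m k : nat) :
  (forall x, iter m f x = x) -> forall x, iter (k * m) f x = x.
Proof. by move=> fm x; elim: k => // k IHk; rewrite mulSn iterD IHk fm. Qed.

Lemma iter_skew_shift (S : finComNzRingType) (n : nat) (f : S -> S) (k : nat)
    (c : 'rV[S]_n) (i : 'I_n) :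
  iter k (@skew_shift S n f) c ord0 i =
    iter k f (c ord0 (iter k (@ord_pred n) i)).
Proof. by elim: k i => // k IHk i; rewrite iterS mxE IHk -iterSr. Qed.

Lemma iter_cyclic_shift (S : finComNzRingType) (n : nat) (k : nat)
    (c : 'rV[S]_n) (i : 'I_n) :
  iter k (@cyclic_shift S n) c ord0 i = c ord0 (iter k (@ord_pred n) i).
Proof. by elim: k i => // k IHk i; rewrite iterS mxE IHk -iterSr. Qed.

Lemma skew_cyclic_quasi_cyclic (S : finComNzRingType) (n : nat) (f : S -> S)
    (e : nat) (C : {set 'rV[S]_n}) :
  0 < e -> (forall x, iter e f x = x) -> skew_cyclic f C ->
  quasi_cyclic (gcdn n e) C.
Proof.
move=> e_gt0 fe [linC shiftC]; split=> // [|c Cc]; first exact: dvdn_gcdl.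
(* This form of Bezout has only nonnegative terms, [gcdn n e + a * n = b * e], so both sides can
   count iterations. *)
have [a _] := Bezoutl n e_gt0; rewrite gcdnC => /dvdnP[b def_m].
suff ->: iter (gcdn n e) (@cyclic_shift S n) c
         = iter (b * e) (@skew_shift S n f) c.
  by elim: (b * e)%N => //= k; apply: shiftC.
apply/rowP => i.
(* The [b * e] applications of [f] cancel; the [b * e] moves of the index are then split into
   [gcdn n e] moves and [a] full turns. *)
rewrite iter_cyclic_shift iter_skew_shift iter_mul_id // -def_m iterD.
by rewrite (iter_mul_id _ _ _ _ (@iter_ord_pred_id n)).
Qed.

Lemma code_equiv_refl (S : finComNzRingType) (n : nat) (C : {set 'rV[S]_n}) :
  code_equiv C C.
Proof.
exists 1%g; rewrite -[LHS]imset_id.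
by apply: eq_imset => c; rewrite col_perm1.
Qed.

(** Carries the group-theoretic order over to function iteration, through powers in the permutation
    group of the ring. *)
Lemma iter_theta_order (p : nat) (alpha : {unit 'F_p}) (x : FpvFp p) :
  iter #[theta_perm alpha]%g (theta alpha) x = x.
Proof.
rewrite -[RHS]perm1 -(expg_order (theta_perm alpha)) permX.
by apply: eq_iter => y; rewrite permE.
Qed.

Theorem proposition4p4 (p : nat) (p_prime : prime p) (p_odd : odd p)
    (alpha : {unit 'F_p}) (e : nat) (e_def : e = #[theta_perm alpha]%g)
    (e_gt1 : 1 < e) (n : nat) (n_gt0 : 0 < n) (e_ndvd_n : ~~ (e %| n))
    (d : nat) (d_def : d = gcdn n e) (C : {set 'rV[FpvFp p]_n}) :
  skew_cyclic (theta alpha) C ->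
  exists D : {set 'rV[FpvFp p]_n}, code_equiv C D /\ quasi_cyclic d D.
Proof.
move=> skewC; exists C; split; first exact: code_equiv_refl.
rewrite d_def; apply: skew_cyclic_quasi_cyclic skewC; first exact: ltnW.
by rewrite e_def; apply: iter_theta_order.
Qed.
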